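(* Let $V = (C[a,b], \Vert \cdot \Vert_\infty)$ be the space of real-valued continuous functions on $[a,b]$ with the sup norm, and let $I : V \to \mathbb{R}$, $I(f) = \int_a^b f(x)\,dx$. For each $n$ let $a \le x_0^{(n)} < x_1^{(n)} < \cdots < x_n^{(n)} \le b$ be nodes and $w_0^{(n)}, \dots, w_n^{(n)} \in \mathbb{R}$ be weights, and let $I_n : V \to \mathbb{R}$ be the quadrature rule $I_n(f) = \sum_{i=0}^n w_i^{(n)} f(x_i^{(n)})$. Suppose that the quadrature rule $(I_n)$ is consistent. Then $(I_n)$ converges to $I$ if and only if $(I_n)$ is stable.
   Context: Definitions: - The quadrature rule $(I_n)$ converges to $I$ (is convergent) if $I_n(f) \to I(f)$ as $n \to \infty$ for every $f \in V$. - It is consistent if there is a dense linear subspace $V_0$ of $V$ such that $I_n(f) \to I(f)$ as $n \to \infty$ for every $f \in V_0$. - It is stable if $\sup_n \Vert I_n \Vert < \infty$, where $\Vert I_n \Vert$ is the norm of $I_n$ as a bounded linear functional on $V$. The nodes are not required to be equally spaced, nor are the nodes for different $n$ required to be nested. *)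

(* Defs.v *)
From HB Require Import structures.
From mathcomp Require Import all_boot all_order all_algebra.
From mathcomp Require Import all_classical all_reals all_analysis.

Set Implicit Arguments.
Unset Strict Implicit.
Unset Printing Implicit Defensive.

Import Order.TTheory GRing.Theory Num.Theory.
Import numFieldNormedType.Exports.

Local Open Scope classical_set_scope.
Local Open Scope ring_scope.

(* C[a,b].  An element is represented by its extension by zero to the whole
   line: this makes Leibniz equality coincide with equality on [a,b], and lets
   the functions be evaluated and integrated as functions R -> R.  Continuity
   is only required on [a,b], for the subspace topology; see segfunP. *)
Definition is_segfun (R : realType) (a b : R) : {pred R -> R} :=
  [pred f : R -> R | `[< {within `[a, b], continuous f} /\
                         (forall x, x \notin `[a, b] -> f x = 0) >]].

Record segfun (R : realType) (a b : R) := SegFun {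
  segfun_val :> R -> R;
  _ : segfun_val \in is_segfun a b }.

HB.instance Definition _ (R : realType) (a b : R) :=
  [isSub for @segfun_val R a b].
HB.instance Definition _ (R : realType) (a b : R) :=
  [Choice of segfun a b by <:].

Lemma is_segfun_submod (R : realType) (a b : R) :
  submod_closed (is_segfun a b).
Proof.
split; first by apply/asboolP; split => // x; exact: cst_continuous.
move=> k f g /asboolP[cf zf] /asboolP[cg zg]; apply/asboolP; split.
  move=> x; apply: cvgD; last exact: cg.
  by apply: cvgZl_tmp; exact: cf.
by move=> x xab; rewrite addrfctE scalrfctE zf// zg// scaler0 addr0.
Qed.

HB.instance Definition _ (R : realType) (a b : R) :=
  GRing.isSubmodClosed.Build R (R -> R) (is_segfun a b)
    (is_segfun_submod a b).
HB.instance Definition _ (R : realType) (a b : R) :=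
  [SubChoice_isSubLmodule of segfun a b by <:].

Definition supnorm (R : realType) (a b : R) (f : segfun a b) : R :=
  sup [set `|f x| | x in `[a, b]].

Section segfun_normed.
Context (R : realType) (a b : R).
Implicit Types f g : segfun a b.

Lemma segfun_continuous f : {within `[a, b], continuous f}.
Proof. by case: f => f /= /asboolP[]. Qed.

Lemma segfun_out f x : x \notin `[a, b] -> f x = 0.
Proof. by case: f => f /= /asboolP[_]; apply. Qed.

Lemma segfunP (h : R -> R) : {within `[a, b], continuous h} ->
  exists f, forall x, x \in `[a, b] -> f x = h x.
Proof.
move=> ch; pose h0 := patch (fun=> 0) `[a, b] h.
have h0E : {in `[a, b], h0 =1 h}.
  by move=> x xab; rewrite /h0 patchT// inE.
suff P : h0 \in is_segfun a b by exists (SegFun P).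
apply/asboolP; split.
  apply: subspace_eq_continuous ch => x; rewrite inE /= => xab.
  by apply/esym; exact: h0E.
by move=> x /negP xab; rewrite /h0 patchN// notin_setE.
Qed.

Lemma segfun_has_ubound f : has_ubound [set `|f x| | x in `[a, b]].
Proof.
have := compact_bounded
  (continuous_compact (@segfun_continuous f) (@segment_compact R a b)).
case=> M [_ /(_ (M + 1))]; rewrite ltrDl ltr01 => /(_ isT) H.
by exists (M + 1) => _ [x xab <-]; apply: H; exists x.
Qed.

Lemma supnorm_ub f x : x \in `[a, b] -> `|f x| <= supnorm f.
Proof.
by move=> xab; apply: ub_le_sup; [exact: segfun_has_ubound|exists x].
Qed.

Lemma supnorm_le f M : 0 <= M -> (forall x, x \in `[a, b] -> `|f x| <= M) ->
  supnorm f <= M.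
Proof.
move=> M0 fM; rewrite /supnorm.
have [->|/set0P ne] := eqVneq [set `|f x| | x in `[a, b]] set0.
  by rewrite sup0.
by apply: ge_sup => // _ [x xab <-]; exact: fM.
Qed.

Lemma supnorm_ge0 f : 0 <= supnorm f.
Proof.
rewrite /supnorm.
have [->|/set0P[y [x xab _]]] := eqVneq [set `|f x| | x in `[a, b]] set0.
  by rewrite sup0.
exact: le_trans (supnorm_ub f xab).
Qed.

Lemma supnormD f g : supnorm (f + g) <= supnorm f + supnorm g.
Proof.
apply: supnorm_le => [|x xab]; first by rewrite addr_ge0 ?supnorm_ge0.
by rewrite (le_trans (ler_normD _ _))// lerD// supnorm_ub.
Qed.

Lemma supnormZ_le (k : R) f : supnorm (k *: f) <= `|k| * supnorm f.
Proof.
apply: supnorm_le => [|x xab]; first by rewrite mulr_ge0 ?supnorm_ge0.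
by rewrite [X in `|X|](_ : _ = k * f x)// normrM ler_wpM2l// supnorm_ub.
Qed.

Lemma supnormZ (k : R) f : supnorm (k *: f) = `|k| * supnorm f.
Proof.
apply/eqP; rewrite eq_le supnormZ_le /=.
have [->|k0] := eqVneq k 0; first by rewrite normr0 mul0r supnorm_ge0.
have := supnormZ_le k^-1 (k *: f).
by rewrite scalerA mulVf// scale1r normfV ler_pdivlMl// normr_gt0.
Qed.

Lemma supnorm0_eq0 f : supnorm f = 0 -> f = 0.
Proof.
move=> f0; apply/val_inj/funext => x /=.
have [xab|] := boolP (x \in `[a, b]); last exact: segfun_out.
by apply/eqP; rewrite -normr_le0 -f0 supnorm_ub.
Qed.

HB.instance Definition _ := Lmodule_isNormed.Build R (segfun a b)
  supnormD supnormZ supnorm0_eq0.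

Lemma segfun_normE f : `|f| = sup [set `|f x| | x in `[a, b]].
Proof. by []. Qed.

End segfun_normed.

Definition integral_functional (R : realType) (a b : R) (f : segfun a b) : R :=
  \int[lebesgue_measure]_(x in `[a, b]) f x.

Definition quadrature (R : realType) (a b : R) (n : nat)
    (x w : 'I_n.+1 -> R) (f : segfun a b) : R :=
  \sum_(i < n.+1) w i * f (x i).

Section rules.
Context (R : realType) (V : normedModType R).

(* In \bar R, so that an unbounded functional has norm +oo. *)
Definition opnorm (L : V -> R) : \bar R :=
  ereal_sup [set `|L f|%:E | f in [set f : V | `|f| <= 1]].

Definition convergent (J : nat -> V -> R) (I : V -> R) : Prop :=
  forall f : V, J n f @[n --> \oo] --> I f.

Definition consistent (J : nat -> V -> R) (I : V -> R) : Prop :=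
  exists V0 : {pred V},
    [/\ submod_closed V0, dense [set` V0] &
        forall f : V, f \in V0 -> J n f @[n --> \oo] --> I f].

Definition stable (J : nat -> V -> R) : Prop :=
  (ereal_sup (range (fun n => opnorm (J n))) < +oo)%E.

End rules.

(* Main.v *)
Require Import Defs.
From HB Require Import structures.
From mathcomp Require Import all_boot all_order all_algebra.
From mathcomp Require Import all_classical all_reals all_analysis.
From mathcomp Require Import ring.
Import Order.TTheory GRing.Theory Num.Theory.
Import numFieldNormedType.Exports.
Local Open Scope ring_scope.

(** Both implications are facts about sequences of continuous linear
    functionals [J n] on a normed space [V], used here with [V = C[a,b]].

    If [J] converges at every [f], each sequence [J n f] is bounded, and as [V]
    is complete, the Banach-Steinhaus theorem bounds the [J n] uniformly on the
    unit ball ([convergent_stable]).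

    Conversely, if the norms of the [J n] are at most [M] and [f] is
    approximated by some [g] in the dense subspace on which [J] converges, then
    [|I f - J n f| <= |I f - I g| + |I g - J n g| + M |g - f|]; the outer terms
    are small when [g] is close to [f], the middle one when [n] is large
    ([consistent_stable_convergent]).

    What is specific to [C[a,b]] is that it is complete, a uniform limit of
    continuous functions being continuous ([segfun_complete]), that a
    quadrature rule is a continuous linear functional, being a finite
    combination of point evaluations ([quadrature_continuous]), and that the
    integral is continuous ([integral_functional_continuous]). *)

(** * Sequences of functionals on a normed space *)

Section functionals.
Context (R : realType) (V : normedModType R).

(** Replaces the [\bar R]-valued operator norms by a real bound on the unit ball,
    the form in which Banach-Steinhaus delivers uniform boundedness. *)
Lemma stableP (J : nat -> V -> R) :
  stable J <-> exists M, forall n f, `|f| <= 1 -> `|J n f| <= M.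
Proof.
rewrite /stable; split => [Jfin|[M JM]].
  have Js n f : `|f| <= 1 ->
      (`|J n f|%:E <= ereal_sup (range (fun n => opnorm (J n))))%E.
    move=> f1; apply: (@le_trans _ _ (opnorm (J n))).
      by apply: ereal_sup_ubound; exists f.
    by apply: ereal_sup_ubound; exists n.
  move: Jfin Js; case: (ereal_sup _) => [M _ JM|//|_ JM].
    by exists M => n f /(JM n); rewrite lee_fin.
  by exists 0 => n f /(JM n); rewrite leeNy_eq.
apply: (@le_lt_trans _ _ M%:E); last exact: ltry.
apply: ge_ereal_sup => _ [n _ <-].
by apply: ge_ereal_sup => _ [f f1 <-]; rewrite lee_fin; exact: JM.
Qed.

Lemma linear_unit_ball_bound (L : {linear V -> R^o}) (M : R) :
  (forall f, `|f| <= 1 -> `|L f| <= M) -> forall f, `|L f| <= M * `|f|.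
Proof.
move=> LM f; have [->|f0] := eqVneq f 0; first by rewrite linear0 !normr0 mulr0.
have f_gt0 : 0 < `|f| by rewrite normr_gt0.
have := LM (`|f|^-1 *: f).
rewrite linearZ /= !normrZ normfV normr_id mulVf ?normr_eq0// => /(_ (lexx _)).
by rewrite ler_pdivrMl// mulrC.
Qed.

Lemma lipschitz_continuous (I : V -> R) (M : R) :
  (forall f g, `|I f - I g| <= M * `|f - g|) -> continuous I.
Proof.
move=> IM f; apply/cvgrPdist_le => e e0.
have M1 : 0 < `|M| + 1 by rewrite ltr_wpDl.
have d0 : 0 < e / (`|M| + 1) by rewrite divr_gt0.
have /cvgrPdist_le/(_ _ d0) := @cvg_id _ (nbhs f).
apply: filterS => g; rewrite ler_pdivlMr// mulrC => fg.
rewrite (le_trans (IM f g))// (le_trans _ fg)// ler_wpM2r//.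
by rewrite (le_trans (ler_norm M))// lerDl.
Qed.

(** An [e / 3] argument: stability makes the error committed by replacing [f]
    with a nearby [g] uniform in [n], so that the convergence of [J n g] passes
    to [f]. *)
Lemma consistent_stable_convergent
    (J : nat -> {linear V -> R^o}) (I : V -> R) :
  continuous I -> consistent (fun n => J n : V -> R) I ->
  stable (fun n => J n : V -> R) -> convergent (fun n => J n : V -> R) I.
Proof.
move=> cI [V0 [_ V0dense JV0]] /stableP[M JM] f.
have JMf n := @linear_unit_ball_bound (J n) M (JM n).
have M0 : 0 <= M.
  by have := JM 0%N 0; rewrite normr0 ler01 linear0 normr0; apply.
apply/cvgrPdist_lt => e e0.
have e3 : 0 < e / 3 by rewrite divr_gt0.
(* [M + 1] rather than [M], which may be zero *)
have r0 : 0 < e / 3 / (M + 1) by rewrite divr_gt0 ?ltr_wpDl.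
have : nbhs f [set g | `|I f - I g| < e / 3 /\ `|f - g| < e / 3 / (M + 1)]%classic.
  apply: filterI.
    by have /cvgrPdist_lt/(_ _ e3) := cI f.
  by have /cvgrPdist_lt/(_ _ r0) := (@cvg_id _ (nbhs f)).
rewrite nbhsE => -[U [Uo Uf] UP].
have [|g [/UP[Ig fg] V0g]] := V0dense U _ Uo; first by exists f.
have /cvgrPdist_lt/(_ _ e3) := JV0 g V0g.
apply: filterS => n Jg.
rewrite (_ : I f - J n f = I f - I g + (I g - J n g) + (J n g - J n f)); last first.
  by rewrite !addrA !subrK.
rewrite (le_lt_trans (ler_normD _ _))//.
have -> : e = e / 3 + e / 3 + e / 3 by field.
apply: ltr_leD.
  by rewrite (le_lt_trans (ler_normD _ _))// ltrD.
rewrite -linearB (le_trans (JMf _ _))// distrC.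
rewrite (le_trans (ler_wpM2l M0 (ltW fg)))// mulrA ler_pdivrMr ?ltr_wpDl//.
by rewrite mulrC ler_pM2l// lerDl.
Qed.

End functionals.

(** The uniform boundedness principle: a convergent sequence of reals is bounded,
    so convergence makes the family of the [J n] pointwise bounded. *)
Lemma convergent_stable (R : realType) (V : completeNormedModType R)
    (J : nat -> {linear V -> R^o}) (I : V -> R) :
  (forall n, continuous (J n)) ->
  convergent (fun n => J n : V -> R) I -> stable (fun n => J n : V -> R).
Proof.
move=> cJ JI; apply/stableP.
pose F : set (V -> R^o) := range (fun n => J n : V -> R^o).
have FL g : F g -> bounded_fun_norm g /\ linear g.
  move=> [n _ <-]; split; last exact: linearP.
  exact/bounded_funP/linear_bounded_continuous.
have Fb : pointwise_bounded F.
  move=> f; have /cvg_seq_bounded[M [_ JM]] : cvgn (fun n => J n f : R^o).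
    by apply/cvg_ex; exists (I f); exact: JI.
  by exists (M + 1) => _ [n _ <-]; apply: JM => //; rewrite ltrDl.
have [M FM] := Banach_Steinhauss FL Fb 1.
by exists M => n f; apply: FM; exists n.
Qed.

(** * The space of continuous functions on a segment *)

Section segfun_space.
Context (R : realType) (a b : R).
Implicit Types f g : segfun a b.

(** The sup norm dominates the evaluation at every real because elements of
    [segfun a b] vanish outside [[a, b]]. *)
Lemma segfun_norm_eval f x : `|f x| <= `|f|.
Proof.
have [xab|/segfun_out ->] := boolP (x \in `[a, b]); first exact: supnorm_ub.
by rewrite normr0.
Qed.

(** A Cauchy filter [F] converges at each point because [R] is complete; the
    Cauchy estimate being uniform over the points, so is the convergence to the
    pointwise limit [h], which is therefore continuous on the segment. *)
Lemma segfun_complete (F : set_system (segfun a b)) :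
  ProperFilter F -> cauchy F -> cvg F.
Proof.
move=> FF /cauchy_ballP Fc.
have Fcn e : 0 < e -> \forall f \near F, \forall g \near F, `|f - g| < e.
  by move=> e0; apply: nearP_dep; apply: filterS (Fc e e0) => -[f g].
have cvgx x : cvg ((fun f => f x) @ F)%classic.
  apply: cauchy_cvg; apply: cauchy_exP => e e0.
  have [f Ff] := filter_ex (Fcn e e0); exists (f x).
  apply: filterS Ff => g; rewrite -ball_normE /=; apply: le_lt_trans.
  exact: (segfun_norm_eval (f - g) x).
pose h x := lim ((fun f => f x) @ F)%classic.
have Fh e : 0 < e -> \forall f \near F, forall x, `|h x - (f : segfun a b) x| <= e.
  move=> e0; have e2 : 0 < e / 2 by rewrite divr_gt0.
  apply: filterS (Fcn _ e2) => f fe x.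
  have /cvgrPdist_lt/(_ _ e2) hx := cvgx x.
  (* [g] may depend on [x]; the bound on [|f - g|] does not *)
  have [g [hg fg]] := filter_ex (filterI hx fe).
  rewrite (le_trans (ler_distD (g x) _ _))// [leRHS]splitr lerD ?(ltW hg)//.
  rewrite distrC; apply: le_trans (ltW fg); exact: (segfun_norm_eval (f - g) x).
have hP : h \in is_segfun a b.
  apply/asboolP; split; last first.
    move=> x xab; rewrite /h (_ : (fun f => f x) = fun=> 0).
      exact: lim_cst.
    by apply/funext => f; exact: segfun_out.
  apply: (@uniform_limit_continuous_subspace _ _ _ (@segfun_val R a b @ F)%classic).
    by near_simpl; apply: filterE => f; exact: segfun_continuous.
  move=> P /uniform_nbhs[E [+ EP]].
  rewrite -entourage_ballE => -[e /= e0 eE].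
  have e2 : 0 < e / 2 by rewrite divr_gt0.
  apply: filterS (Fh _ e2) => f hf; apply: EP => x _; apply: eE => /=.
  by rewrite -ball_normE /= (le_lt_trans (hf x))// gtr_pMr// invf_lt1// ltr1n.
apply/cvg_ex; exists (SegFun hP); apply/cvgrPdist_le => e e0.
apply: filterS (Fh e e0) => f hf.
by apply: supnorm_le => [|x _]; [exact: ltW|exact: hf].
Qed.

HB.instance Definition _ := Uniform_isComplete.Build (segfun a b) segfun_complete.

Lemma quadrature_linear n (x w : 'I_n.+1 -> R) :
  linear (quadrature x w : segfun a b -> R^o).
Proof.
move=> k f g; rewrite /quadrature scaler_sumr -big_split /=.
by apply: eq_bigr => i _; rewrite mulrDr mulrCA.
Qed.

HB.instance Definition _ n (x w : 'I_n.+1 -> R) :=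
  GRing.isLinear.Build R (segfun a b) R^o _ (quadrature x w)
    (quadrature_linear n x w).

Lemma quadrature_continuous n (x w : 'I_n.+1 -> R) :
  continuous (quadrature x w : segfun a b -> R).
Proof.
apply/linear_bounded_continuous/bounded_funP => r.
exists (\sum_(i < n.+1) `|w i| * r) => f fr.
apply: le_trans (ler_norm_sum _ _ _) _; apply: ler_sum => i _.
by rewrite normrM ler_wpM2l// (le_trans (segfun_norm_eval f (x i))).
Qed.

Lemma integral_functional_lipschitz f g :
  `|integral_functional f - integral_functional g| <=
  fine (@lebesgue_measure R `[a, b]) * `|f - g|.
Proof.
have intf (u : segfun a b) :
    lebesgue_measure.-integrable `[a, b]%classic (EFin \o u).
  apply: continuous_compact_integrable; first exact: segment_compact.
  exact: segfun_continuous.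
rewrite /integral_functional -RintegralB//.
rewrite (le_trans (le_normr_Rintegral _ (intf (f - g))))//.
rewrite mulrC -Rintegral_cst//; apply: le_Rintegral => //.
- exact: integrable_norm (intf (f - g)).
- apply: continuous_compact_integrable; first exact: segment_compact.
  by move=> y; exact: cvg_cst.
- by move=> y _; exact: (segfun_norm_eval (f - g)).
Qed.

Lemma integral_functional_continuous :
  continuous (@integral_functional R a b).
Proof.
exact: lipschitz_continuous integral_functional_lipschitz.
Qed.

End segfun_space.

Theorem theorem4p3 (R : realType) (a b : R)
  (x w : forall n : nat, 'I_n.+1 -> R)
  (x_ge : forall n, a <= x n ord0)
  (x_lt : forall n (i j : 'I_n.+1), (i < j)%N -> x n i < x n j)
  (x_le : forall n, x n ord_max <= b) :
  let I : segfun a b -> R := @integral_functional R a b in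
  let J : nat -> segfun a b -> R := fun n => quadrature (x n) (w n) in
  consistent J I -> (convergent J I <-> stable J).
Proof.
move=> I J cJI.
pose L n : {linear segfun a b -> R^o} := quadrature (x n) (w n).
split.
- by apply: (@convergent_stable _ _ L) => n; exact: quadrature_continuous.
- apply: (@consistent_stable_convergent _ _ L) => //.
  exact: integral_functional_continuous.
Qed.
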